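(* Let $n=2r+1\ge 7$. If a simple $n$-vertex hypergraph contains a Hamiltonian Berge cycle $C$ whose hyperedges all have size at least $r$, and an additional hyperedge $f\notin E(C)$ of size at least $r$, then the hyperedges in $E(C)\cup\{f\}$ form a Berge-pancyclic hypergraph (on the same vertex set). In particular, for every odd $n\ge 7$ and $r=(n-1)/2$, every simple $n$-vertex $r$-uniform hypergraph that contains a Hamiltonian Berge cycle $C$ and at least one edge outside $E(C)$ is Berge-pancyclic.
   Context: All hypergraphs are finite and simple: the edge family consists of distinct subsets of the vertex set. A Berge cycle of length $\ell\ge 2$ is an alternating sequence $x_0h_0x_1h_1\cdots x_{\ell-1}h_{\ell-1}x_0$ with distinct vertices $x_i$, distinct hyperedges $h_i$, and $\{x_i,x_{i+1}\}\subseteq h_i$ for every $i$ (indices modulo $\ell$); its edge set is $E(C)=\{h_0,\dots,h_{\ell-1}\}$. It is Hamiltonian if it contains every vertex. An $n$-vertex hypergraph is Berge-pancyclic if it contains Berge cycles of every length $2,3,\dots,n$. *)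

(* Defs.v *)
From mathcomp Require Import all_boot.

Set Implicit Arguments.
Unset Strict Implicit.
Unset Printing Implicit Defensive.

(* The vertex set is the whole of T. A family of distinct subsets of T is a
   set of sets, so every such H is simple; the empty set is a possible edge. *)
Definition hypergraph (T : finType) := {set {set T}}.

Section Berge.
Variable T : finType.
Implicit Types (H : hypergraph T) (l : nat).

(* E(C) for the cycle C = x_0 h_0 x_1 h_1 ... x_(l-1) h_(l-1) x_0. *)
Definition cycle_edges l (h : 'I_l -> {set T}) : hypergraph T :=
  [set h i | i : 'I_l].

(* [ordS i] is i + 1 modulo l. *)
Definition berge_cycle H l (x : 'I_l -> T) (h : 'I_l -> {set T}) : Prop :=
  [/\ 2 <= l,
      injective x,
      injective h,
      forall i : 'I_l, [set x i; x (ordS i)] \subset h i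
    & cycle_edges h \subset H].

Definition hamiltonian_berge_cycle H l (x : 'I_l -> T)
    (h : 'I_l -> {set T}) : Prop :=
  berge_cycle H x h /\ (forall v : T, exists i : 'I_l, x i = v).

Definition berge_pancyclic H : Prop :=
  forall l, 2 <= l <= #|T| ->
    exists (x : 'I_l -> T) (h : 'I_l -> {set T}), berge_cycle H x h.

Definition uniform (r : nat) H : Prop :=
  forall e : {set T}, e \in H -> #|e| = r.

End Berge.

(* Main.v *)
(** Index the vertices by Z_n along C. A hyperedge lying outside a Hamiltonian
    cycle with this vertex order and containing some a and a + d closes an arc
    of C into a Berge cycle of length d + 1. If no such hyperedge contains a
    pair at distance d (2 <= d <= n - 2), each extra hyperedge e satisfies
    |e| = r, and e and e + d partition all vertices but one, the gap p, which
    determines e; so all extra hyperedges are translates of one set. An extra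
    hyperedge containing i and i + 1 can be exchanged with h_i. Let R be f
    together with the h_i, i in I, obtained by repeated exchanges. Each member
    of R contains the same number m > 0 of consecutive pairs, all indexed by I,
    while each consecutive pair lies in at most m members of R because these
    are distinct translates. Hence m (|I| + 1) <= m |I|, a contradiction.
    Length 2 follows by counting pairs of vertices inside the hyperedges. *)

Require Import Defs.
From mathcomp Require Import all_boot all_fingroup all_algebra zify.

Set Implicit Arguments.
Unset Strict Implicit.
Unset Printing Implicit Defensive.

Import GRing.Theory.

(** * Transport of Berge cycles, and length two *)

Lemma berge_cycle_sub (T : finType) (H H' : hypergraph T) l (x : 'I_l -> T) h :
  H \subset H' -> berge_cycle H x h -> berge_cycle H' x h.
Proof. by move=> sHH' [? ? ? ? /subset_trans]; split; auto. Qed.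

Lemma berge_cycle_imset (S T : finType) (phi : S -> T) (H : hypergraph S) l
    (x : 'I_l -> S) (h : 'I_l -> {set S}) :
  injective phi -> berge_cycle H x h ->
  berge_cycle [set phi @: e | e : {set S} in H] (phi \o x) (fun i => phi @: h i).
Proof.
move=> phi_inj [l2 x_inj h_inj xh hH]; split=> //.
- exact: inj_comp.
- by move=> i j /(imset_inj phi_inj)/h_inj.
- by move=> i; rewrite /= -!(imset_set1 phi) -imsetU imsetS.
- apply/subsetP=> _ /imsetP[i _ ->]; apply: imset_f.
  by apply: (subsetP hH); apply/imsetP; exists i.
Qed.

(** If no pair of vertices lay in two hyperedges, counting pairs would give
    [(2r + 2) * 'C(r, 2) <= 'C(2r + 1, 2)], that is [r^2 - 1 <= 2r + 1], which fails from [r = 3]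
    on. *)
Lemma berge_2cycle (T : finType) (H : hypergraph T) (r : nat) :
  3 <= r -> #|T| = 2 * r + 1 -> 2 * r + 2 <= #|H| ->
  (forall e, e \in H -> r <= #|e|) ->
  exists (x : 'I_2 -> T) (h : 'I_2 -> {set T}), berge_cycle H x h.
Proof.
move=> r3 cT cH He.
have [/existsP[B /andP[B2 /card_gt1P[e1 [e2 []]]]] | nB] :=
  boolP [exists B : {set T}, (#|B| == 2) && (1 < #|[set e in H | B \subset e]|)].
  rewrite !inE => /andP[H1 B1] /andP[H2 Be2] e12.
  have /cards2P[a [b [ab defB]]] := B2.
  exists (fun i : 'I_2 => if i == ord0 then a else b).
  exists (fun i : 'I_2 => if i == ord0 then e1 else e2).
  have I2 (i : 'I_2) : i = ord0 \/ i = ord_max.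
    by case: i => [[|[|//]]] ?; [left | right]; apply: val_inj.
  split=> //.
  - move=> i j; case: (I2 i) => ->; case: (I2 j) => -> //= /eqP;
      by rewrite ?(negPf ab) // eq_sym (negPf ab).
  - move=> i j; case: (I2 i) => ->; case: (I2 j) => -> //= /eqP;
      by rewrite ?(negPf e12) // eq_sym (negPf e12).
  - have S0 : ordS (ord0 : 'I_2) = ord_max by apply: val_inj.
    have S1 : ordS (ord_max : 'I_2) = ord0 by apply: val_inj.
    move=> i; case: (I2 i) => ->; rewrite ?S0 ?S1 /=; first by rewrite -defB.
    by rewrite setUC -defB.
  - by apply/subsetP=> _ /imsetP[i _ ->]; case: ifP.
have : \sum_(e in H) 'C(#|e|, 2) <= 'C(#|T|, 2).
  (* Double counting of incidences between hyperedges and the pairs inside them. *)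
  have -> : \sum_(e in H) 'C(#|e|, 2) =
      \sum_(e in H) \sum_(B : {set T} | #|B| == 2) (B \subset e).
    apply: eq_bigr => e _; rewrite -cards_draws -sum1dep_card big_mkcondl.
    rewrite [RHS]big_mkcond [LHS]big_mkcond /=.
    by apply: eq_bigr => B _; case: (#|B| == 2); case: (B \subset e).
  rewrite exchange_big /=.
  have -> : 'C(#|T|, 2) = \sum_(B : {set T} | #|B| == 2) 1.
    rewrite -cardsT -cards_draws sum1dep_card; apply: eq_card => B.
    by rewrite !inE subsetT.
  apply: leq_sum => B B2; rewrite -big_mkcondr sum1dep_card leqNgt.
  apply: contraNN nB => B_gt1; apply/existsP; exists B; rewrite B2 /=.
  by rewrite (leq_trans B_gt1) // subset_leq_card //; apply/subsetP=> e; rewrite !inE.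
have : \sum_(e in H) 'C(r, 2) <= \sum_(e in H) 'C(#|e|, 2).
  by apply: leq_sum => e /He; exact: leq_bin2l.
move=> /leq_trans le /le; rewrite sum_nat_const cT => {}le.
have : (2 * r + 2) * 'C(r, 2) <= 'C(2 * r + 1, 2).
  by apply: leq_trans le; rewrite leq_mul2r cH orbT.
have C2 k : 'C(k.+1, 2) * 2 = k.+1 * k.
  by rewrite bin2 muln2 -[RHS]odd_double_half /= oddM /= andNb.
case: r r3 {cT cH He le} => // r r3.
move: (C2 r) (C2 (2 * r.+1)); rewrite addn1; nia.
Qed.

(** * Subsets of Z_n avoiding a difference *)

Section Rotation.
Variable m : nat.
Local Notation Zn := 'I_m.+2.
Implicit Types (e : {set Zn}) (d : Zn).
Local Open Scope ring_scope.

(** The positions [i] at which [e] could serve as the hyperedge h_i. *)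
Definition sees e : {set Zn} := [set i in e | i + 1 \in e].

Definition avoids d e := [forall (a | a \in e), a + d \notin e].

(** The point missed by both [e] and its translate by [d], phrased as a recurrence: away from [p],
    each shift by [d] flips membership. *)
Definition gap d e (p : Zn) :=
  p - d \notin e /\ forall x, (x \in e) = (x != p) && (x - d \notin e).

(** [e] and its translate [ed] are disjoint, each with at least [r] of the [2r + 1] points, so their
    union misses exactly one. *)
Lemma avoids_gap r d e :
  (m.+2 = 2 * r + 1)%N -> (r <= #|e|)%N -> avoids d e -> exists p, gap d e p.
Proof.
move=> nE re /forall_inP av.
pose ed := [set x | x - d \in e].
have cd : #|ed| = #|e|.
  rewrite -(card_imset e (addIr d)); apply: eq_card => x; rewrite inE.
  apply/idP/imsetP=> [xe | [y ye ->]]; last by rewrite addrK.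
  by exists (x - d); rewrite ?subrK.
have dis : [disjoint e & ed].
  rewrite disjoint_sym disjoints_subset; apply/subsetP=> x; rewrite !inE.
  by move=> /av; rewrite subrK.
have cU : #|e :|: ed| = (#|e| + #|e|)%N.
  by rewrite cardsU disjoint_setI0 // cards0 cd subn0.
have /cards1P[p pE] : #|~: (e :|: ed)| == 1%N.
  have := cardsC (e :|: ed); rewrite cU card_ord; lia.
have out x : (x \notin e) && (x - d \notin e) = (x == p).
  by move/setP/(_ x): pE; rewrite !inE negb_or.
exists p; split=> [|x]; first by have := out p; rewrite eqxx => /andP[].
have xed : ~~ ((x \in e) && (x - d \in e)).
  by apply/negP=> /andP[xe xde]; have /negP := av _ xde; rewrite subrK.
by rewrite -out; case: (x \in e) xed; case: (x - d \in e).
Qed.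

(** Walking back from [p] by steps of [d], membership reads out, out, in, out, in, and so on, until
    [p] recurs. *)
Lemma gap_mem d e p j x : gap d e p -> x + d *+ j = p ->
  (forall t, (t < j)%N -> x + d *+ t != p) -> (x \in e) = (0 < j)%N && ~~ odd j.
Proof.
move=> [pde gp]; elim: j x => [|[|j] IH] x.
- by rewrite addr0 => -> _; rewrite gp eqxx.
- by move=> /(canRL (addrK _)) -> _; rewrite mulr1n (negPf pde).
move=> xj xt.
have := IH (x + d); rewrite -addrA -mulrS => /(_ xj) IHx.
have xd : (x + d \in e) = ~~ odd j.+1.
  by apply: IHx => t tj; rewrite -addrA -mulrS; apply: xt.
have xdp : x + d != p := xt 1%N isT.
by move: xd; rewrite gp addrK xdp /=; case: (x \in e); case: odd.
Qed.

Lemma gap_reach d e p x : odd m -> gap d e p -> exists j, x + d *+ j == p.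
Proof.
move=> om [_ gp].
(* Off the gap membership alternates along the d-orbit, whose length is odd. *)
have [/existsP[j ?]|] := boolP [exists j : 'I_m.+3, x + d *+ j == p].
  by exists j.
move=> /existsPn xj.
have alt j : (j < m.+3)%N -> (x + d *+ j \in e) = (x \in e) (+) odd j.
  elim: j => [|j IH] jm; first by rewrite addr0 addbF.
  rewrite gp (xj (Ordinal jm)) mulrSr addrA addrK IH ?(ltnW jm) //=.
  by case: (_ \in _); case: odd.
(* After [m.+2] shifts, an odd number, the orbit is back at [x] with its membership flipped. *)
have := alt m.+2 (leqnn _).
have -> : d *+ m.+2 = 0 by apply: val_inj; rewrite Zp_mulrn /= modnMl.
by rewrite addr0 /= negbK om addbT; case: (x \in e).
Qed.

(* Membership of [x] only depends on the least [j] with [x + d *+ j = p]. *)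
Lemma gap_translate d e e' p p' x : odd m -> gap d e p -> gap d e' p' ->
  (x \in e) = (x + (p' - p) \in e').
Proof.
move=> om ge ge'.
have [j /eqP jp jmin] := ex_minnP (gap_reach x om ge).
have sh t : x + (p' - p) + d *+ t - p' = x + d *+ t - p.
  by rewrite [p' - p]addrC addrA [LHS]addrAC addrK addrAC.
rewrite (@gap_mem d e p j) // ?(@gap_mem d e' p' j) //.
- by apply/eqP; rewrite -subr_eq0 sh jp subrr.
- by move=> t tj; rewrite -subr_eq0 sh subr_eq0; apply: contraTneq tj => /eqP/jmin;
    rewrite leqNgt.
- by move=> t; apply: contraTneq => /eqP/jmin; rewrite leqNgt.
Qed.

Lemma natr_neq0 j : (0 < j < m.+2)%N -> j%:R != 0 :> Zn.
Proof.
by case/andP=> j0 jn; rewrite Zp_nat -val_eqE /= modn_small // -lt0n.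
Qed.

Lemma natr_order : m.+2%:R = 0 :> Zn.
Proof. by rewrite Zp_nat; apply: val_inj; rewrite /= modnn. Qed.

Lemma avoids_sees r (d : nat) e : (m.+2 = 2 * r + 1)%N -> (2 <= d <= m)%N ->
  (r <= #|e|)%N -> avoids d%:R e -> sees e != set0.
Proof.
move=> nE /andP[d2 dm] re /forall_inP av; apply/eqP=> s0.
have [|q [_ gq]] := avoids_gap (d := 1) nE re.
  by apply/forall_inP=> x xe; move/setP/(_ x): s0; rewrite !inE xe /= => ->.
(* Without consecutive pairs [e] is [q + 1, q + 3, ..., q + n - 2]. *)
have qj j : (0 < j < m.+2)%N -> (q + j%:R \in e) = odd j.
  elim: j => // j IH jm.
  have -> : (q + j.+1%:R \in e) = (q + j%:R \notin e).
    by rewrite gq -subr_eq0 addrAC subrr add0r natr_neq0 // mulrSr addrA addrK.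
  case: j IH jm => [|j] IH jm; first by rewrite addr0 gq eqxx.
  by rewrite IH //= ltnW.
have q1 : q + 1 \in e := qj 1%N isT.
(* For odd [d], the offset [n - d + 1] is odd and adding [d] wraps around to [q + 1]; for even [d],
   the offsets [1] and [d + 1] are both odd. The bounds on [d] keep these offsets below [n]. *)
have [od|ed] := boolP (odd d).
  have /av/negP[] : q + (m.+2 - d).+1%:R \in e by rewrite qj; lia.
  have -> : q + (m.+2 - d).+1%:R + d%:R = q + (m.+2 + 1)%:R.
    by rewrite -addrA -natrD; congr (q + _%:R); lia.
  by rewrite natrD natr_order add0r.
have /negP[] := av _ q1.
have -> : q + 1 + d%:R = q + d.+1%:R by rewrite mulrS addrA.
by rewrite qj.
Qed.

(** * Exchanging hyperedges *)

(* A family [E] encodes the n + 1 hyperedges: [E (Some i)] is h_i and [E None]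
   is the extra hyperedge. *)
Definition step (E : option Zn -> {set Zn}) : rel (option Zn) :=
  fun u v => if v is Some i then i \in sees (E u) else false.

(** An arc from the extra hyperedge to [Some i] permits swapping it with h_i, which becomes the new
    extra one. Performing the swaps along a simple path makes its last hyperedge the extra one. *)
Lemma path_exchange (P : {set Zn} -> Prop) (E : option Zn -> {set Zn}) p :
    (forall s : {perm option Zn},
      (forall i, i \in sees (E (s (Some i)))) -> P (E (s None))) ->
    (forall i, i \in sees (E (Some i))) ->
  path (step E) None p -> uniq (None :: p) -> P (E (last None p)).
Proof.
elim: p E => [|v p IH] E PE Ei.
  by move=> _ _; have := PE 1%g; rewrite perm1; apply=> i; rewrite perm1.
case: v => [i|] //= /andP[st pth] /andP[]; rewrite inE /= => Np /andP[ip up].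
pose t := tperm None (Some i).
(* Simplicity of the path keeps the swap off its remaining vertices, so it stays a path for
   [E \o t]. *)
have tp : {in p, forall w, t w = w}.
  move=> w wp; rewrite tpermD //; first by apply: contraNneq Np => ->.
  by apply: contraNneq ip => ->.
have tpath q u : {in q, forall w, t w = w} ->
    path (step E) (t u) q = path (step (E \o t)) u q.
  elim: q u => //= w q IHq u tq; congr (_ && _).
  rewrite -IHq ?tq ?mem_head // => z zq; apply: tq.
  by rewrite inE zq orbT.
have := IH (E \o t); rewrite /= -last_map (map_id_in tp) /t tpermL; apply.
- move=> s sE; have := PE (s * t)%g; rewrite permM; apply=> j.
  by rewrite permM; apply: sE.
- move=> j; have [<-|ij] := eqVneq i j; first by rewrite /= tpermR.
  by rewrite /= tpermD // (inj_eq Some_inj).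
- by rewrite -tpath // /t tpermL.
- by rewrite Np.
Qed.

Lemma exists_exchange r (d : nat) (E : option Zn -> {set Zn}) :
    (m.+2 = 2 * r + 1)%N -> (2 <= d <= m)%N -> injective E ->
    (forall u, (r <= #|E u|)%N) -> (forall i, i \in sees (E (Some i))) ->
  exists2 s : {perm option Zn}, forall i, i \in sees (E (s (Some i)))
    & ~~ avoids d%:R (E (s None)).
Proof.
move=> nE dm Einj Er Ei.
have [/existsP[s /andP[/forallP ? ?]]|/existsPn ns] := boolP
  [exists s : {perm option Zn},
    [forall i, i \in sees (E (s (Some i)))] && ~~ avoids d%:R (E (s None))].
  by exists s.
have om : odd m by lia.
pose R := [set u | connect (step E) None u].
have avR u : u \in R -> avoids d%:R (E u).
  rewrite inE => /connectP[p0 /shortenP[p pth up _] ->].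
  apply: (path_exchange (P := fun e => avoids d%:R e)) pth up => // s sE.
  by have := ns s; rewrite negb_and negbK => /orP[/negP[]|//]; apply/forallP.
have NR : None \in R by rewrite inE connect0.
have [p gapR] : exists p : option Zn -> Zn, forall u, u \in R -> gap d%:R (E u) (p u).
  apply: (@fin_all_exists _ _ (fun u q => u \in R -> gap d%:R (E u) q)) => u.
  have [uR|] := boolP (u \in R); last by exists 0.
  by have [q] := avoids_gap nE (Er u) (avR _ uR); exists q.
(* The gap determines the set, so shifting by the difference of gaps carries [E u] onto [E None]. *)
pose c u := p None - p u.
have tr u x : u \in R -> (x \in E u) = (x + c u \in E None).
  by move=> uR; apply: gap_translate om (gapR _ uR) (gapR _ NR).
have seesR u i : u \in R -> (i \in sees (E u)) = (i + c u \in sees (E None)).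
  by move=> uR; rewrite ![_ \in sees _]inE (tr u i) // (tr u (i + 1)) // addrAC.
have cardR u : u \in R -> #|sees (E u)| = #|sees (E None)|.
  move=> uR; rewrite -(card_imset _ (addIr (c u))); apply: eq_card => y.
  apply/imsetP/idP=> [[x xu ->]|yN]; first by rewrite -seesR.
  by exists (y - c u); rewrite ?subrK // (seesR u) // subrK.
pose I := [set i | Some i \in R].
have cR : #|R| = #|I|.+1.
  have -> : R = None |: (Some @: I).
    apply/setP=> [[i|]]; rewrite in_setU1; last by rewrite NR eqxx.
    by rewrite mem_imset ?[i \in I]inE //; apply: Some_inj.
  rewrite cardsU1 card_imset; last exact: Some_inj.
  by case: imsetP => // [[]].
have cA (A : {set Zn}) : A \subset I -> #|A| = (\sum_(i in I) (i \in A))%N.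
  move=> sAI; rewrite -big_mkcondr -sum1_card; apply: eq_bigl => i.
  by case: (boolP (i \in A)) => [/(subsetP sAI) ->|]; rewrite ?andbF.
have sRI u : u \in R -> sees (E u) \subset I.
  rewrite inE => uR; apply/subsetP=> i iu; rewrite !inE.
  by apply: connect_trans uR (connect1 _).
(* For fixed [i], the shift [c u] determines [E u] and hence [u], so [u] maps injectively to
   [i + c u] in [sees (E None)]. *)
have codeg i : (\sum_(u in R) (i \in sees (E u)) <= #|sees (E None)|)%N.
  rewrite -big_mkcondr sum1dep_card -(card_in_imset (f := fun u => i + c u)).
    apply/subset_leq_card/subsetP=> _ /imsetP[u /setIdP[uR iu] ->].
    by rewrite -seesR.
  move=> u v /setIdP[uR _] /setIdP[vR _] /addrI cuv; apply: Einj.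
  by apply/setP=> x; rewrite (tr u) // (tr v) // cuv.
(* Both sums have equal positive terms, but [R] has one more member than [I]. *)
have : (\sum_(u in R) #|sees (E u)| <= \sum_(i in I) #|sees (E None)|)%N.
  rewrite (eq_bigr _ (fun u uR => cA _ (sRI u uR))) exchange_big /=.
  by apply: leq_sum => i _; apply: codeg.
rewrite (eq_bigr _ cardR) !sum_nat_const cR leq_pmul2r ?ltnn //.
by rewrite card_gt0 (avoids_sees nE dm) // avR.
Qed.

(** * Closing arcs and assembling all lengths *)

Lemma chord_cycle (d : nat) (E : option Zn -> {set Zn}) a : (0 < d < m.+2)%N ->
    injective E -> (forall i, i \in sees (E (Some i))) ->
    a \in E None -> a + d%:R \in E None ->
  exists (x : 'I_d.+1 -> Zn) (h : 'I_d.+1 -> {set Zn}),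
    berge_cycle [set E u | u : option Zn] x h.
Proof.
move=> /andP[d0 dm] Einj Ei aN adN.
pose x (k : 'I_d.+1) : Zn := a + (k : nat)%:R.
have xinj : injective x.
  have small (k : 'I_d.+1) : (k < m.+2)%N := leq_trans (ltn_ord k) dm.
  move=> i j /addrI; rewrite !Zp_nat => /(congr1 val) /=.
  by rewrite !modn_small ?small // => /val_inj.
(* The arc from [a] to [a + d] uses its own hyperedges; the extra one closes it. *)
pose g (k : 'I_d.+1) := if (k < d)%N then Some (x k) else None.
exists x, (E \o g); split=> //.
- apply: inj_comp => // i j; rewrite /g.
  case: ltnP => ilt; case: ltnP => jlt //; first by move=> /Some_inj/xinj.
  by move=> _; apply: val_inj => /=; have := ltn_ord i; have := ltn_ord j; lia.
- move=> k; rewrite subUset !sub1set /= /g /x; case: ltnP => kd.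
    have := Ei (a + (k : nat)%:R); rewrite inE => /andP[-> /=].
    by rewrite modn_small // mulrSr addrA.
  have kE : (k : nat) = d by have := ltn_ord k; lia.
  by rewrite kE adN /= kE modnn addr0.
- by apply/subsetP=> _ /imsetP[k _ ->]; apply: imset_f.
Qed.

End Rotation.

Lemma ordSE m (i : 'I_m.+2) : ordS i = (i + 1)%R.
Proof. by apply: val_inj; rewrite /= addn1. Qed.

Lemma hamiltonian_extra_pancyclic (T : finType) (r l : nat) (H : hypergraph T)
    (x : 'I_l -> T) (h : 'I_l -> {set T}) (f : {set T}) :
  3 <= r -> #|T| = 2 * r + 1 -> hamiltonian_berge_cycle H x h ->
  (forall e, e \in cycle_edges h -> r <= #|e|) ->
  f \notin cycle_edges h -> r <= #|f| ->
  berge_pancyclic (f |: cycle_edges h).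
Proof.
move=> r3 cT [[l2 x_inj h_inj xh hH] x_surj] hr fh fr.
have cyc : berge_cycle (f |: cycle_edges h) x h by split=> //; apply: subsetUr.
have lT : l = #|T|.
  rewrite -[LHS]card_ord -(card_codom x_inj); apply: eq_card => v.
  by have [i <-] := x_surj v; rewrite codom_f.
case: l => [|[|m]] // in x h l2 x_inj h_inj xh hH x_surj hr fh cyc lT *.
(* The bijection [x] moves everything to Z_n, where the cycle order is [i], [i + 1]. *)
pose pre (A : {set T}) := x @^-1: A.
have preK A : x @: pre A = A.
  apply/setP=> v; have [i <-] := x_surj v.
  by rewrite mem_imset // inE.
pose F u := if u is Some i then h i else f.
have FE : [set F u | u : option 'I_m.+2] = f |: cycle_edges h.
  apply/setP=> e; rewrite in_setU1; apply/imsetP/orP.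
    by case=> [[i|]] _ -> /=; [right; apply: imset_f | left].
  by case=> [/eqP ->|/imsetP[i _ ->]]; [exists None | exists (Some i)].
have Fr u : r <= #|F u| by case: u => [i|] //=; apply: hr; apply: imset_f.
have Finj : injective F.
  case=> [i|] [j|] //= E; first by rewrite (h_inj _ _ E).
    by rewrite -E imset_f in fh.
  by rewrite E imset_f in fh.
have preI : injective pre by move=> A B AB; rewrite -(preK A) AB preK.
have Einj : injective (pre \o F) := inj_comp preI Finj.
have Er u : r <= #|(pre \o F) u| by rewrite -(card_imset _ x_inj) preK.
have Ei i : i \in sees ((pre \o F) (Some i)).
  by have := xh i; rewrite subUset !sub1set !inE -ordSE.
move=> k /andP[k2 kT].
have [->|kneqT] := eqVneq k #|T|; first by rewrite -lT; exists x, h.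
have [->|kneq2] := eqVneq k 2.
  apply: (berge_2cycle r3 cT); last by rewrite -FE => _ /imsetP[u _ ->].
  by rewrite -FE card_imset // card_option card_ord lT cT addn1 addn2.
(* Length [d.+1] needs a chord at distance [d]; with lengths 2 and [n] settled, [2 <= d <= m]
   remains. *)
case: k => // d in k2 kT kneqT kneq2 *.
have [||s sE] := @exists_exchange m r d _ _ _ Einj Er Ei; [lia | lia |].
rewrite negb_forall_in => /exists_inP[a aN]; rewrite negbK => adN.
have [||y [g]] := @chord_cycle m d (pre \o F \o s) a _ _ sE aN adN.
- lia.
- by apply: inj_comp Einj _; apply: perm_inj.
move/(berge_cycle_imset x_inj)/berge_cycle_sub.
move=> cyc'; eexists; eexists; apply: cyc'.
apply/subsetP=> _ /imsetP[_ /imsetP[u _ ->] ->] /=.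
by rewrite preK -FE imset_f.
Qed.

Theorem corollary1p4 (T : finType) (n r : nat) (hT : #|T| = n) (hn : 7 <= n)
    (H : hypergraph T) :
  (n = 2 * r + 1 ->
   forall (l : nat) (x : 'I_l -> T) (h : 'I_l -> {set T}) (f : {set T}),
     hamiltonian_berge_cycle H x h ->
     (forall e : {set T}, e \in cycle_edges h -> r <= #|e|) ->
     f \in H -> f \notin cycle_edges h -> r <= #|f| ->
     berge_pancyclic (f |: cycle_edges h))
  /\
  (odd n -> r = (n - 1) %/ 2 -> uniform r H ->
   (exists (l : nat) (x : 'I_l -> T) (h : 'I_l -> {set T}),
      hamiltonian_berge_cycle H x h /\
      exists f : {set T}, f \in H /\ f \notin cycle_edges h) ->
   berge_pancyclic H).
Proof.
split=> [nE l x h f ham hr _ fh fr | on rE unif [l [x [h [ham [f [fH fh]]]]]] k kT].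
  by apply: hamiltonian_extra_pancyclic ham hr fh fr; lia.
have hH : cycle_edges h \subset H by case: ham => [[]].
have hr e : e \in cycle_edges h -> r <= #|e| by move/(subsetP hH)/unif->.
have [|||y [g cyc]] := hamiltonian_extra_pancyclic _ _ ham hr fh _ kT.
- lia.
- lia.
- by rewrite (unif f).
exists y, g; apply: berge_cycle_sub cyc.
by rewrite subUset sub1set fH.
Qed.
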